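(* If $k\ge 3$, then the perfect matching derangement graph $M(2k)$ is not a Cayley graph.
   Context: A perfect matching of $K_{2k}$ is a set of $k$ pairwise vertex-disjoint edges. $M(2k)$ is the graph whose vertices are the perfect matchings of $K_{2k}$, two being adjacent iff they share no edge. A graph is a Cayley graph if it is isomorphic to $\mathrm{Cay}(G,C)$ for some group $G$ and inverse-closed subset $C\subseteq G\setminus\{1\}$, with vertex set $G$ and $g\sim h$ iff $hg^{-1}\in C$. *)

(* Defs.v *)
From mathcomp Require Import all_boot all_fingroup.
Set Implicit Arguments. Unset Strict Implicit. Unset Printing Implicit Defensive.
Local Open Scope group_scope.

Definition perfect_matching (n : nat) (M : {set {set 'I_n}}) : bool :=
  [forall e in M, #|e| == 2%N] && [forall v : 'I_n, #|[set e in M | v \in e]| == 1%N].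

Definition pm_vertex (n : nat) := {M : {set {set 'I_n}} | perfect_matching M}.

Definition pm_adj (n : nat) : rel (pm_vertex n) :=
  fun M N => (val M :&: val N) == set0.

(* A (finite) graph (V, adj) is a Cayley graph if it is isomorphic to
   Cay(G, C) for a group G (here the full group of a finGroupType; the
   vertex set is finite so G must be finite) and an inverse-closed
   C ⊆ G \ {1}, where g ~ h iff h g^-1 ∈ C. *)
Definition is_cayley_graph (V : finType) (adj : rel V) : Prop :=
  exists (gT : finGroupType) (C : {set gT}) (f : V -> gT),
    [/\ bijective f,
        1 \notin C,
        (forall c, c \in C -> c^-1 \in C) &
        (forall x y : V, adj x y = (f y * (f x)^-1 \in C))].

(* Main.v *)
Require Import Defs.
From mathcomp Require Import all_boot all_fingroup.
From mathcomp Require Import pgroup.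
Set Implicit Arguments. Unset Strict Implicit. Unset Printing Implicit Defensive.

(* Let [switch M N] mean that M and N differ in exactly two edges.  A line
   {M, N, P}, i.e. the three matchings through a common set of k - 2 edges, is
   recognised by the graph: the three are distinct and pairwise intersecting,
   and a matching meeting two of them meets the third.  Hence graph
   automorphisms preserve switches.  If Q meets M, then Q misses a switch N of M
   iff all edges common to M and Q are among the two switched ones; so "Q and Q'
   meet M in the same single edge" is also a graph property.  It follows that
   automorphisms permute the edges of K_{2k}, preserving disjointness, and hence
   come from permutations of the points.

   A Cayley structure thus gives a subgroup H of Sym(2k) regular on perfect
   matchings.  An involution fixes some matching, so |H| is odd.  An odd group
   transitive on the matchings of an even set fixes a point of it; so H fixes
   some a, and for b <> a the stabiliser H_b fixes exactly one further point c,
   with H_b = H_c.  Then b <-> c is a fixed-point-free pairing of the odd set of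
   points other than a, which is absurd. *)

(** * Perfect matchings as fixed-point-free involutions *)

Section Mate.
Context {n : nat}.
Implicit Types (M N : pm_vertex n) (x y : 'I_n).

(** The default [x] is never returned: in a perfect matching every point has a partner, see
    [mate_neq]. *)
Definition mate M x : 'I_n :=
  odflt x [pick y | (y != x) && ([set x; y] \in val M)].

Lemma vertex_edge_card M (e : {set 'I_n}) : e \in val M -> #|e| = 2.
Proof. by case: M => M /= /andP[/forall_inP h _] /h /eqP. Qed.

Lemma vertex_edge_unique M x : exists e, forall e', (e' \in val M) && (x \in e') = (e' == e).
Proof.
case: M => M /= /andP[_ /forallP/(_ x)/cards1P[e /setP he]].
by exists e => e'; have := he e'; rewrite !inE.
Qed.

Lemma mate_eqE M x y : (mate M x == y) = (x != y) && ([set x; y] \in val M).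
Proof.
have [e he] := vertex_edge_unique M x.
have /andP[eM xe] : (e \in val M) && (x \in e) by rewrite he.
have /cards2P[a [b [ab ee]]] : #|e| == 2 by rewrite (vertex_edge_card eM).
have [z zx ez] : exists2 z, z != x & e = [set x; z].
  move: xe; rewrite ee !inE => /orP[/eqP->|/eqP->].
    by exists b => //; rewrite eq_sym.
  by exists a => //; rewrite setUC.
have key y' : y' != x -> [set x; y'] \in val M -> y' = z.
  move=> yx yM; have : [set x; y'] == e by rewrite -he yM !inE eqxx.
  rewrite ez => /eqP/setP/(_ y'); rewrite !inE eqxx orbT (negbTE yx) /=.
  by move/esym/eqP.
rewrite /mate; case: pickP => [y' /andP[yx yM]|/(_ z)] /=; last by rewrite zx -ez eM.
rewrite (key _ yx yM); apply/eqP/andP => [<-|[xy h]].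
  by rewrite eq_sym zx -ez.
by rewrite (key y) // eq_sym.
Qed.

Lemma mate_neq M x : mate M x <> x.
Proof. by apply/eqP; rewrite mate_eqE eqxx. Qed.

Lemma mateK M : involutive (mate M).
Proof.
move=> x; apply/eqP; rewrite mate_eqE eq_sym setUC -mate_eqE //.
Qed.

Lemma mate_edge M x : [set x; mate M x] \in val M.
Proof. by have := mate_eqE M x (mate M x); rewrite eqxx => /esym/andP[]. Qed.

Lemma edge_mate M (e : {set 'I_n}) : e \in val M -> exists x, e = [set x; mate M x].
Proof.
move=> eM; have /cards2P[a [b [ab ee]]] : #|e| == 2 by rewrite (vertex_edge_card eM).
exists a; rewrite ee; congr [set a; _]; apply/esym/eqP.
by rewrite mate_eqE ab -ee.
Qed.

Lemma pm_adjP M N : reflect (forall x, mate M x <> mate N x) (pm_adj M N).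
Proof.
apply: (iffP eqP) => [h x e|h].
  have: [set x; mate M x] \in val M :&: val N by rewrite inE {2}e !mate_edge.
  by rewrite h inE.
apply/setP => e; rewrite !inE; apply/negP => /andP[eM eN].
have [x ex] := edge_mate eM; case: (h x); apply/esym/eqP.
by rewrite mate_eqE -ex eN andbT eq_sym; apply/eqP/mate_neq.
Qed.

Lemma pm_adjPn M N : reflect (exists x, mate M x = mate N x) (~~ pm_adj M N).
Proof.
apply: (iffP negP) => [h|[x e] /pm_adjP/(_ x)//].
have [/existsP[x /eqP]|/existsPn h'] := boolP [exists x, mate M x == mate N x].
  by exists x.
by case: h; apply/pm_adjP => x; apply/eqP.
Qed.

Lemma mate_inj M N : mate M =1 mate N -> M = N.
Proof.
move=> h; apply/val_inj/setP => e; apply/idP/idP => /edge_mate[x ->].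
  by rewrite h mate_edge.
by rewrite -h mate_edge.
Qed.

(** Together with [mate_inj] this identifies vertices with fixed-point-free involutions, so that
    matchings can be built as functions. *)
Lemma mate_surj (p : 'I_n -> 'I_n) :
  (forall x, p x <> x) -> involutive p -> exists M, mate M =1 p.
Proof.
move=> pn pK; pose M := [set [set x; p x] | x in 'I_n].
have hM : perfect_matching M.
  apply/andP; split.
    apply/forall_inP => _ /imsetP[x _ ->]; rewrite cards2.
    by rewrite (introF eqP (not_eq_sym (pn x))).
  apply/forallP => x; apply/cards1P; exists [set x; p x]; apply/setP => e.
  rewrite !inE; apply/andP/eqP => [[/imsetP[y _ ->]]|->].
    by rewrite !inE => /orP[/eqP->|/eqP->] //; rewrite pK setUC.
  by split; [apply: imset_f | rewrite !inE eqxx].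
exists (Sub M hM) => x; apply/eqP; rewrite mate_eqE SubK; apply/andP; split.
  exact/eqP/not_eq_sym/pn.
exact: imset_f.
Qed.

End Mate.

Arguments mate_neq {n} M x _.

(** * Matchings of a finite set that avoid two given involutions *)

Section Matching.
Context {T : finType}.
Implicit Types (D E : {set T}) (p q M N : T -> T).

(** A matching of [D] is a total function whose values off [D] are arbitrary; this makes restricting
    and gluing easy. *)
Definition matching_on D p :=
  forall x, x \in D -> [/\ p x \in D, p x <> x & p (p x) = x].

Definition avoids D p M := forall x, x \in D -> p x <> M x.

Lemma even_matching_on D p : matching_on D p -> ~~ odd #|D|.
Proof.
have [m] := ubnP #|D|; elim: m D => // m IH D Dm pD.
have [->|[x xD]] := set_0Vmem D; first by rewrite cards0.
have [pxD pxx ppx] := pD x xD.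
have e : #|D| = #|D :\ x :\ p x|.+2.
  by rewrite (cardsD1 x) xD (cardsD1 (p x) (D :\ x)) !inE pxD andbT; case: eqP.
rewrite e /= negbK; apply: IH; first by rewrite e in Dm; apply: ltnW.
move=> y; rewrite !inE => /and3P[/eqP ypx /eqP yx yD].
have [pyD pyy ppy] := pD y yD; split=> //.
by apply/and3P; split=> //; apply/eqP; congruence.
Qed.

Lemma matching_on_glue D E p q : [disjoint D & E] ->
  matching_on D p -> matching_on E q ->
  matching_on (D :|: E) (fun x => if x \in D then p x else q x).
Proof.
move=> dDE pD qE x; rewrite inE; case: ifP => [xD _|_ /= xE].
  by have [pxD pxx ppx] := pD x xD; rewrite inE pxD.
have [qxE qxx qqx] := qE x xE; rewrite inE qxE orbT.
by rewrite (disjointFl dDE qxE).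
Qed.

Lemma matching_on_pair x y : x <> y ->
  matching_on [set x; y] (fun z => if z == x then y else x).
Proof.
move=> /eqP xy z; rewrite !inE eq_sym in xy *.
move=> /orP[]/eqP->; rewrite ?eqxx ?(negbTE xy) ?eqxx ?orbT; split=> //; apply/eqP=> //.
by rewrite eq_sym.
Qed.

(** The edge {x, p x} is replaced by {u, x} and {v, p x}; the four inequalities say that neither new
    edge belongs to [M] or [N]. *)
Lemma avoids_insert_at D p M N u v x :
  involutive M -> involutive N ->
  matching_on D p -> avoids D p M -> avoids D p N ->
  u \notin D -> v \notin D -> u <> v -> x \in D ->
  [/\ M u <> x, N u <> x, M v <> p x & N v <> p x] ->
  exists q, [/\ matching_on (u |: (v |: D)) q, avoids (u |: (v |: D)) q M
              & avoids (u |: (v |: D)) q N].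
Proof.
move=> MK NK pD pM pN uD vD uv xD [Mux Nux Mvy Nvy].
have [yD yx py] := pD x xD; set y := p x in Mvy Nvy yD yx py *.
pose q z := if z == u then x else if z == x then u else
            if z == v then y else if z == y then v else p z.
have nu z : z \in D -> z <> u by move=> zD e; move: uD; rewrite -e zD.
have nv z : z \in D -> z <> v by move=> zD e; move: vD; rewrite -e zD.
have [[[xu yu] xv] yv] := (nu _ xD, nu _ yD, nv _ xD, nv _ yD).
have qu : q u = x by rewrite /q eqxx.
have qx : q x = u by rewrite /q (introF eqP xu) eqxx.
have qv : q v = y.
  by rewrite /q (introF eqP (not_eq_sym uv)) (introF eqP (not_eq_sym xv)) eqxx.
have qy : q y = v by rewrite /q (introF eqP yu) (introF eqP yx) (introF eqP yv) eqxx.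
have qz z : z \in D -> z <> x -> z <> y -> q z = p z.
  move=> zD zx zy; rewrite /q.
  by rewrite (introF eqP (nu _ zD)) (introF eqP zx) (introF eqP (nv _ zD)) (introF eqP zy).
have cases z : z \in u |: (v |: D) ->
    [\/ z = u, z = v, z = x | z = y] \/ [/\ z \in D, z <> x & z <> y].
  rewrite !inE => /or3P[/eqP->|/eqP->|zD].
  - by left; constructor 1.
  - by left; constructor 2.
  have [->|/eqP zx] := eqVneq z x; first by left; constructor 3.
  have [->|/eqP zy] := eqVneq z y; first by left; constructor 4.
  by right.
have pxy : p x = y by [].
have MKx := MK x; have MKy := MK y; have NKx := NK x; have NKy := NK y.
exists q; split=> z /cases [[]->|[zD zx zy]];
  try by [congruence | rewrite qz //; apply: pM | rewrite qz //; apply: pN].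
- by rewrite qu !inE xD !orbT; split=> //; congruence.
- by rewrite qv !inE yD !orbT; split=> //; congruence.
- by rewrite qx !inE eqxx; split=> //; congruence.
- by rewrite qy !inE eqxx !orbT; split=> //; congruence.
have [pzD pzz ppz] := pD z zD; rewrite qz // !inE pzD !orbT; split=> //.
by rewrite qz //; congruence.
Qed.

(* Either u and v can be joined, or uv lies in M, say; then N alone obstructs
   replacing an edge {x, p x} by {u,x}, {v,p x} or by {u,p x}, {v,x}, and it
   cannot obstruct both. *)
Lemma avoids_insert D p M N u v :
  involutive M -> involutive N ->
  matching_on D p -> avoids D p M -> avoids D p N ->
  u \notin D -> v \notin D -> u <> v -> D != set0 ->
  exists q, [/\ matching_on (u |: (v |: D)) q, avoids (u |: (v |: D)) q M
              & avoids (u |: (v |: D)) q N].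
Proof.
move=> MK NK pD pM pN uD vD uv /set0Pn[x xD].
have [yD yx py] := pD x xD.
have nu z : z \in D -> z <> u by move=> zD e; move: uD; rewrite -e zD.
have nv z : z \in D -> z <> v by move=> zD e; move: vD; rewrite -e zD.
have [[[xu yu] xv] yv] := (nu _ xD, nu _ yD, nv _ xD, nv _ yD).
have insx := avoids_insert_at MK NK pD pM pN uD vD uv xD.
have insy := avoids_insert_at MK NK pD pM pN uD vD uv yD; rewrite py in insy.
have MI := inv_inj MK; have NI := inv_inj NK.
have Muv := MK u; have Nuv := NK u.
have [Mu|/eqP Mu] := eqVneq (M u) v.
  have [Nux|/eqP Nux] := eqVneq (N u) x.
    by apply: insy; split; try congruence; move=> e; apply: uv; apply: NI; congruence.
  have [Nvy|/eqP Nvy] := eqVneq (N v) (p x).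
    by apply: insy; split; try congruence; move=> e; apply: uv; apply: NI; congruence.
  by apply: insx; split=> //; congruence.
have [Nu|/eqP Nu] := eqVneq (N u) v.
  have [Mux|/eqP Mux] := eqVneq (M u) x.
    by apply: insy; split; try congruence; move=> e; apply: uv; apply: MI; congruence.
  have [Mvy|/eqP Mvy] := eqVneq (M v) (p x).
    by apply: insy; split; try congruence; move=> e; apply: uv; apply: MI; congruence.
  by apply: insx; split=> //; congruence.
pose q z := if z == u then v else if z == v then u else p z.
have qu : q u = v by rewrite /q eqxx.
have qv : q v = u by rewrite /q (introF eqP (not_eq_sym uv)) eqxx.
have qz z : z \in D -> q z = p z.
  by move=> zD; rewrite /q (introF eqP (nu _ zD)) (introF eqP (nv _ zD)).
have Mvu : M v <> u by move=> e; apply: Mu; rewrite -e MK.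
have Nvu : N v <> u by move=> e; apply: Nu; rewrite -e NK.
exists q; split=> z; rewrite !inE => /or3P[/eqP->|/eqP->|zD];
  try by [congruence | rewrite qz //; apply: pM | rewrite qz //; apply: pN].
- by rewrite qu eqxx orbT; split=> //; congruence.
- by rewrite qv eqxx; split=> //; congruence.
have [pzD pzz ppz] := pD z zD; rewrite qz // pzD !orbT; split=> //.
by rewrite qz.
Qed.

(** Induction on the size of [D], inserting two points at a time into a smaller avoiding matching.
    The bound 4 matters: on two points the only matching may be an edge of [M]. *)
Lemma avoiding_matching D M N :
  involutive M -> involutive N -> ~~ odd #|D| -> 4 <= #|D| ->
  exists p, [/\ matching_on D p, avoids D p M & avoids D p N].
Proof.
move=> MK NK; have [m] := ubnP #|D|; elim: m D => // m IH D Dm Dodd D4.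
have [u uD] : exists u, u \in D by apply/card_gt0P; apply: leq_trans D4.
have [D6|D5] := leqP 6 #|D|.
  have [v vD] : exists v, v \in D :\ u.
    by apply/card_gt0P; move: D4; rewrite (cardsD1 u) uD; case: #|_|.
  have [D' eD [uD' vD' uv]] : exists2 D', D = u |: (v |: D') & [/\ u \notin D', v \notin D' & u <> v].
    exists (D :\ u :\ v); first by rewrite setD1K // setD1K.
    by rewrite !inE !eqxx andbF; split=> //; apply/eqP; move: vD; rewrite !inE eq_sym => /andP[].
  have cD : #|D| = #|D'|.+2.
    by rewrite eD cardsU1 !inE (negbTE uD') orbF (introF eqP uv) cardsU1 vD'.
  move: Dm Dodd D6; rewrite cD /= negbK !ltnS => Dm Dodd D6.
  have [p [pD pM pN]] := IH D' (ltnW Dm) Dodd D6.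
  rewrite eD; apply: (avoids_insert MK NK pD pM pN uD' vD' uv).
  by rewrite -card_gt0; apply: leq_trans D6.
have {D5 Dm} D4e : #|D| = 4 by move: D4 D5 Dodd; case: #|D| => [|[|[|[|[|[|]]]]]].
(* One of the four points lies outside {u, M u, N u}; the edge {u, v} is then the seed into which
   the other two points are inserted. *)
have [v vD [uv Mv Nv]] : exists2 v, v \in D & [/\ v <> u, v <> M u & v <> N u].
  have : 0 < #|D :\: [set u; M u; N u]|.
    rewrite cardsD D4e subn_gt0 ltnS; apply: leq_trans (subset_leq_card (subsetIr _ _)) _.
    rewrite -setUA; apply: leq_trans (leq_card_setU _ _) _.
    by rewrite cards1 cards2; case: eqP.
  case/card_gt0P => v; rewrite !inE !negb_or => /andP[/andP[/andP[a b] c] vD].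
  by exists v => //; split; apply/eqP.
pose E := [set u; v].
have cE : #|D :\: E| = 2.
  have sE : E \subset D by apply/subsetP => z; rewrite !inE => /orP[]/eqP->.
  by rewrite cardsD (setIidPr sE) D4e cards2 eq_sym (introF eqP uv).
have /cards2P[a [b [ab eab]]] : #|D :\: E| == 2 by rewrite cE.
have -> : D = a |: (b |: E).
  have sE : E \subset D by apply/subsetP => z; rewrite !inE => /orP[]/eqP->.
  by rewrite setUA -eab setUC; apply/setP=> z; have := subsetP sE z;
     rewrite !inE; case: (_ || _) => //= ->.
have aE : a \notin E by have : a \in D :\: E; [rewrite eab !inE eqxx | rewrite inE => /andP[]].
have bE : b \notin E by have : b \in D :\: E; [rewrite eab !inE eqxx orbT| rewrite inE => /andP[]].
have uv' : u <> v by congruence.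
apply: (avoids_insert MK NK (matching_on_pair uv')) => //.
- move=> z; rewrite !inE => /orP[]/eqP->; rewrite ?eqxx ?(introF eqP uv); first by congruence.
  by move=> e; apply: Mv; rewrite e MK.
- move=> z; rewrite !inE => /orP[]/eqP->; rewrite ?eqxx ?(introF eqP uv); first by congruence.
  by move=> e; apply: Nv; rewrite e NK.
- by apply/eqP.
by apply/set0Pn; exists u; rewrite !inE eqxx.
Qed.

Lemma even_set_matching D : ~~ odd #|D| -> exists p, matching_on D p.
Proof.
have idK : involutive (@id T) by [].
case cD : #|D| => [|[|[|[|m]]]] // Dodd.
- by exists id => x; rewrite (cards0_eq cD) inE.
- have /cards2P[a [b [/eqP ab ->]]] : #|D| == 2 by rewrite cD.
  by eexists; apply: matching_on_pair.
(* Avoiding the identity only says that the matching has no fixed point. *)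
have [||p [pD _ _]] := @avoiding_matching D id id idK idK; try by rewrite cD.
by exists p.
Qed.

End Matching.

(* Quantified hypotheses make congruence search for instances and diverge. *)
Ltac ground_congruence :=
  repeat match goal with H : forall _ : _, _ |- _ => clear H end; congruence.

(** * Extending partial matchings, and switches of two edges *)

Section Switch.
Context {n : nat}.
Hypotheses (n_even : ~~ odd n) (n_ge6 : 6 <= n).
Implicit Types (M N P Q R : pm_vertex n) (x y z : 'I_n).

Lemma mate_matching_on M x : matching_on [set x; mate M x] (mate M).
Proof.
have xx := mate_neq M x; have K := mateK M.
move=> z; rewrite !inE => /orP[]/eqP->; rewrite ?K !eqxx ?orbT; split=> //.
exact: not_eq_sym.
Qed.

Lemma extend_avoiding (E : {set 'I_n}) q P1 P2 :
  matching_on E q -> 4 <= #|~: E| ->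
  exists Q, (forall z, z \in E -> mate Q z = q z) /\
    forall z, z \notin E -> mate Q z <> mate P1 z /\ mate Q z <> mate P2 z.
Proof.
move=> qE E4; have Ee := even_matching_on qE.
have Ce : ~~ odd #|~: E|.
  by move: n_even; rewrite -{1}(card_ord n) -(cardsC E) oddD (negbTE Ee).
have [p [pC p1 p2]] := avoiding_matching (mateK P1) (mateK P2) Ce E4.
have dE : [disjoint E & ~: E] by rewrite -setI_eq0 setICr.
have := matching_on_glue dE qE pC; rewrite setUCr.
set g := fun x => _; move=> gm.
have [Q Qg] : exists Q, mate Q =1 g.
  by apply: mate_surj => z; have [_ ? ?] := gm z (in_setT z).
exists Q; split=> z zE; rewrite Qg /g; first by rewrite zE.
rewrite (negbTE zE); split; [apply: p1 | apply: p2]; by rewrite inE.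
Qed.

(** Here [6 <= n] enters: at least four points remain outside {x, y}, enough to avoid two matchings
    there. *)
Lemma extend_edge P1 P2 x y : x <> y -> exists Q, mate Q x = y /\
  forall z, z <> x -> z <> y -> mate Q z <> mate P1 z /\ mate Q z <> mate P2 z.
Proof.
move=> xy; have [|Q [QE Qn]] := extend_avoiding P1 P2 (matching_on_pair xy).
  rewrite cardsCs setCK card_ord cards2 (introF eqP xy) leq_subRL.
    by apply: leq_trans n_ge6.
  exact: leq_trans n_ge6.
exists Q; split; first by rewrite QE /= ?inE eqxx.
by move=> z zx zy; apply: Qn; rewrite !inE; apply/norP; split; apply/eqP.
Qed.

Lemma exists_mate x y : x <> y -> exists Q, mate Q x = y.
Proof.
move=> xy.
have [|p pC] := @even_set_matching _ (~: [set x; y]).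
  rewrite cardsCs setCK card_ord cards2 (introF eqP xy) oddB ?addbF //.
  exact: leq_trans n_ge6.
have dE : [disjoint [set x; y] & ~: [set x; y]] by rewrite -setI_eq0 setICr.
have := matching_on_glue dE (matching_on_pair xy) pC; rewrite setUCr.
set g := fun x => _; move=> gm.
have [Q Qg] : exists Q, mate Q =1 g.
  by apply: mate_surj => z; have [_ ? ?] := gm z (in_setT z).
by exists Q; rewrite Qg /g !inE eqxx.
Qed.

Lemma glue_edges M N a c :
  c <> a -> c <> mate M a -> mate N c <> a -> mate N c <> mate M a ->
  exists2 q, matching_on [set a; mate M a; c; mate N c] q &
   [/\ q a = mate M a, q c = mate N c & #|[set a; mate M a; c; mate N c]| = 4].
Proof.
move=> ca cb da db; have aa := mate_neq M a; have cc := mate_neq N c.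
have dE : [disjoint [set a; mate M a] & [set c; mate N c]].
  rewrite -setI_eq0; apply/eqP/setP=> z; rewrite !inE; apply/negP.
  by case/andP=> /orP[]/eqP-> /orP[]/eqP; ground_congruence.
have := matching_on_glue dE (@mate_matching_on M a) (@mate_matching_on N c).
rewrite setUA => g; eexists; [exact: g | split].
- by rewrite !inE eqxx.
- by rewrite !inE (introF eqP ca) (introF eqP cb).
by rewrite -setUA cardsU disjoint_setI0 // cards0 subn0 !cards2
  (introF eqP (not_eq_sym aa)) (introF eqP (not_eq_sym cc)).
Qed.

Lemma extend_two_edges M N P a c :
  8 <= n -> c <> a -> c <> mate M a -> mate N c <> a -> mate N c <> mate M a ->
  exists Q, [/\ mate Q a = mate M a, mate Q c = mate N c &
    forall z, z <> a -> z <> mate M a -> z <> c -> z <> mate N c ->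
      mate Q z <> mate P z].
Proof.
move=> n8 ca cb da db; have [q qE [qa qc cE]] := glue_edges ca cb da db.
have [|Q [QE Qn]] := extend_avoiding P P qE.
  by rewrite cardsCs setCK card_ord cE leq_subRL // (leq_trans _ n8).
exists Q; split.
- by rewrite QE // !inE eqxx.
- by rewrite QE // !inE eqxx !orbT.
move=> z za zb zc zd; have [|//] := Qn z.
by rewrite !inE; apply/norP; split; [apply/norP; split; [apply/norP; split|]|]; apply/eqP.
Qed.

Lemma exists_two_mates a b c d : uniq [:: a; b; c; d] ->
  exists Q, mate Q a = b /\ mate Q c = d.
Proof.
rewrite /= !inE !negb_or => /and4P[/and3P[/eqP ab /eqP ac /eqP ad]].
move=> /andP[/eqP bc /eqP bd] /eqP cd _.
have [M Ma] := exists_mate ab; have [N Nc] := exists_mate cd.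
have [] := @glue_edges M N a c; try ground_congruence.
rewrite Ma Nc => q qE [qa qc cE].
have [|p pC] := @even_set_matching _ (~: [set a; b; c; d]).
  rewrite cardsCs setCK card_ord cE oddB ?addbF //.
  exact: leq_trans n_ge6.
have dE : [disjoint [set a; b; c; d] & ~: [set a; b; c; d]] by rewrite -setI_eq0 setICr.
have := matching_on_glue dE qE pC; rewrite setUCr.
set g := fun x => _; move=> gm.
have [Q Qg] : exists Q, mate Q =1 g.
  by apply: mate_surj => z; have [_ ? ?] := gm z (in_setT z).
by exists Q; rewrite !Qg /g !inE !eqxx !orbT.
Qed.

(** The hypotheses say that {u, w} is not the edge {x, y}. For u <> w, extend {x, y} while avoiding
    a matching through {u, w}. The lemma shows that an edge is determined by the matchings
    containing it. *)
Lemma exists_mate_avoiding x y u w : x <> y ->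
  ~ (u = x /\ w = y) -> ~ (u = y /\ w = x) ->
  exists M, mate M x = y /\ mate M u <> w.
Proof.
move=> xy n1 n2; have [uw|/eqP uw] := eqVneq u w.
  by have [M Mx] := exists_mate xy; exists M; split=> //; rewrite uw; apply: mate_neq.
have [P Pu] := exists_mate uw; have [Q [Qx Qn]] := extend_edge P P xy.
exists Q; split=> // Qu; have := mateK Q x; rewrite Qx => Qy.
have [ux|/eqP ux] := eqVneq u x; first by apply: n1; split; ground_congruence.
have [uy|/eqP uy] := eqVneq u y; first by apply: n2; split; ground_congruence.
by have [] := Qn u ux uy; ground_congruence.
Qed.

(** The four listed points span the exchanged edges; the second clause says that the partner of
    [mate M a] in N is the fourth of them. *)
Definition switch_at a M N := 
  [/\ mate M a <> mate N a, mate N (mate M a) = mate M (mate N a) &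
   forall x, x <> a -> x <> mate M a -> x <> mate N a -> x <> mate M (mate N a) ->
     mate M x = mate N x].

Definition switch M N := exists a, switch_at a M N.

Ltac at4 x a b c d e := 
  have [e|/eqP ?] := eqVneq x a; [|
  have [e|/eqP ?] := eqVneq x b; [|
  have [e|/eqP ?] := eqVneq x c; [|
  have [e|/eqP ?] := eqVneq x d; [|]]]].

(** The four exchanged points play symmetric roles, so any of them can be the base point. *)
Lemma switch_everywhere M N x : switch M N -> mate M x <> mate N x -> switch_at x M N.
Proof.
move=> [a [aMN e0 out]] xMN.
have K1 := mateK M a; have K2 := mateK N a; have K3 := mateK M (mate N a).
have K4 := mateK N (mate M a).
at4 x a (mate M a) (mate N a) (mate M (mate N a)) e; last by case: xMN; apply: out.
all: rewrite e in xMN *; split; try ground_congruence.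
all: move=> y *; apply: out; ground_congruence.
Qed.

Lemma switch_det M N1 N2 x : switch M N1 -> switch M N2 ->
  mate N1 x = mate N2 x -> mate M x <> mate N1 x -> N1 = N2.
Proof.
move=> s1 s2 e12 h1.
have [_ e1 o1] := switch_everywhere s1 h1.
have [_ e2 o2] : switch_at x M N2 by apply: switch_everywhere => //; ground_congruence.
have K1 := mateK M x; have K2 := mateK N1 x; have K3 := mateK M (mate N1 x).
have K4 := mateK N1 (mate M x).
have K5 := mateK N2 x; have K6 := mateK N2 (mate M x).
apply: mate_inj => y; at4 y x (mate M x) (mate N1 x) (mate M (mate N1 x)) e;
  rewrite ?e; try ground_congruence.
have {}o1 := o1 y; have {}o2 := o2 y; rewrite -?e12 in o2.
by transitivity (mate M y); [symmetry; apply: o1 | apply: o2].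
Qed.

Lemma exists_switch M x z : z <> x -> z <> mate M x ->
  exists2 N, switch_at x M N & mate N x = z.
Proof.
move=> zx zMx.
(* The edges {x, M x}, {z, M z} become {x, z}, {M x, M z}. *)
pose p y := if y == x then z else if y == z then x else
            if y == mate M x then mate M z else
            if y == mate M z then mate M x else mate M y.
have K1 := mateK M x; have K2 := mateK M z.
have n1 := mate_neq M x; have n2 := mate_neq M z.
have f (u v : 'I_n) : u <> v -> (u == v) = false by move/eqP/negbTE.
have px : p x = z by rewrite /p eqxx.
have pz : p z = x by rewrite /p (f _ _ zx) eqxx.
have pMx : p (mate M x) = mate M z.
  by rewrite /p (f _ _ n1) (f _ _ (not_eq_sym zMx)) eqxx.
have pMz : p (mate M z) = mate M x.
  have h1 : mate M z <> x by ground_congruence.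
  have h3 : mate M z <> mate M x by ground_congruence.
  by rewrite /p (f _ _ h1) (f _ _ n2) (f _ _ h3) eqxx.
have po y : y <> x -> y <> z -> y <> mate M x -> y <> mate M z -> p y = mate M y.
  by move=> h1 h2 h3 h4; rewrite /p !f.
have [N Np] : exists N, mate N =1 p.
  apply: mate_surj => y; at4 y x z (mate M x) (mate M z) e; rewrite ?e; try ground_congruence.
    by rewrite po //; apply: mate_neq.
  have K := mateK M y; rewrite (po y) // po //; ground_congruence.
exists N; last by rewrite Np.
split; rewrite !Np ?px //; first by ground_congruence.
by move=> y *; rewrite Np po.
Qed.

(* The two-edge parts of M and N over the four points where they differ are
   crossing matchings of a K_4, so no matching contains an edge of each. *)
Lemma switch_common_edge M N Q : switch M N ->
  ~~ pm_adj Q M -> ~~ pm_adj Q N -> exists x, mate Q x = mate M x /\ mate M x = mate N x.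
Proof.
move=> s /pm_adjPn[y Qy] /pm_adjPn[z Qz].
have [e|/eqP yMN] := eqVneq (mate M y) (mate N y); first by exists y.
have [e|/eqP zMN] := eqVneq (mate M z) (mate N z); first by exists z; split; ground_congruence.
have [_ e0 out] := switch_everywhere s yMN.
have K1 := mateK M y; have K2 := mateK Q y; have K3 := mateK Q z; have K4 := mateK N y.
have K5 := mateK M (mate N y); have K6 := mateK N z; have K7 := mateK N (mate M y).
by at4 z y (mate M y) (mate N y) (mate M (mate N y)) e; [ground_congruence..|case: zMN; apply: out].
Qed.

(** Four points have exactly three perfect matchings; M and N use two of them and P uses the third,
    pairing [a] with [mate M (mate N a)]. *)
Lemma switch_third M N : switch M N ->
  exists P, [/\ switch M P, switch N P &
   forall x, (mate M x = mate N x <-> mate M x = mate P x) /\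
             (mate M x = mate N x <-> mate N x = mate P x)].
Proof.
move=> [a [aMN e0 out]].
have K1 := mateK M a; have K2 := mateK N a; have K3 := mateK M (mate N a).
have K4 := mateK N (mate M a).
have n1 := mate_neq M a; have n2 := mate_neq N a.
have [||P [aMP e1 out1] Pa] := @exists_switch M a (mate M (mate N a)); try ground_congruence.
have K5 := mateK P a; have K6 := mateK P (mate M a).
exists P; split.
- by exists a; split.
- exists a; split; try ground_congruence.
  by move=> x *; transitivity (mate M x); [symmetry; apply: out | apply: out1]; ground_congruence.
have n3 := mate_neq M (mate N a).
move=> x; at4 x a (mate M a) (mate N a) (mate M (mate N a)) e; rewrite ?e.
- by split; split; ground_congruence.
- by split; split; ground_congruence.
- by split; split; ground_congruence.
- by split; split; ground_congruence.
have h1 : mate M x = mate N x by apply: out.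
have h2 : mate M x = mate P x by apply: out1; ground_congruence.
by split; split; ground_congruence.
Qed.

Lemma switch_meet M N : switch M N -> ~~ pm_adj M N /\ M <> N.
Proof.
move=> [a [aMN e0 out]]; split; last by ground_congruence.
have : 0 < #|~: [set a; mate M a; mate N a; mate M (mate N a)]|.
  rewrite cardsCs setCK card_ord subn_gt0; apply: leq_trans n_ge6; rewrite ltnS.
  do 2 (apply: leq_trans (leq_card_setU _ _) _; rewrite cards1 addn1 ltnS).
  by apply: leq_trans (leq_card_setU _ _) _; rewrite !cards1.
case/card_gt0P=> x; rewrite !inE !negb_or => /andP[/andP[/andP[/eqP ? /eqP ?] /eqP ?] /eqP ?].
by apply/pm_adjPn; exists x; apply: out.
Qed.

(** * Recognising switches by adjacency alone *)

Definition meets_third M N P := forall Q,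
  ~~ pm_adj Q M -> ~~ pm_adj Q N -> ~~ pm_adj Q P.

(* Pairwise intersection matters only for K_6, where the three even (or three
   odd) matchings of a K_{3,3} also satisfy the other two conditions. *)
Definition is_line M N P :=
  [/\ [/\ M <> N, M <> P & N <> P],
      [/\ ~~ pm_adj M N, ~~ pm_adj M P & ~~ pm_adj N P] &
      [/\ meets_third M N P, meets_third M P N & meets_third N P M]].

Lemma switch_line M N : switch M N -> exists P, is_line M N P.
Proof.
move=> sMN; have [P [sMP sNP eq3]] := switch_third sMN; exists P.
have [? ?] := switch_meet sMN; have [? ?] := switch_meet sMP; have [? ?] := switch_meet sNP.
split; split=> // Q h1 h2; apply/pm_adjPn.
- have [x [Qx Mx]] := switch_common_edge sMN h1 h2; exists x; rewrite Qx.
  by have [_ h] := eq3 x; rewrite Mx; apply/h.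
- have [x [Qx Mx]] := switch_common_edge sMP h1 h2; exists x; rewrite Qx.
  by have [h _] := eq3 x; apply/h.
have [x [Qx Mx]] := switch_common_edge sNP h1 h2; exists x; rewrite Qx.
by have [_ h] := eq3 x; apply/esym/h.
Qed.

(** If P lacked an edge common to M and N, a matching through that edge avoiding P elsewhere would
    meet M and N but not P. *)
Lemma line_agree M N P z : meets_third M N P ->
  mate M z = mate N z -> mate M z = mate P z.
Proof.
move=> h e; have [//|/eqP MP] := eqVneq (mate M z) (mate P z).
have [Q [Qz Qn]] := extend_edge P P (not_eq_sym (mate_neq M z)).
have : ~~ pm_adj Q P by apply: h; apply/pm_adjPn; exists z; ground_congruence.
case/pm_adjPn=> y Qy; have K := mateK P z; have K' := mateK P y; have K2 := mateK Q z.
have [|/eqP yz] := eqVneq y z; first by ground_congruence.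
have [|/eqP yMz] := eqVneq y (mate M z); first by ground_congruence.
by have [] := Qn y yz yMz.
Qed.

Lemma line_switch M N P : is_line M N P -> switch M N.
Proof.
move=> [[MN MP NP] [mMN mMP mNP] [h1 h2 h3]].
have [a aMN] : exists a, mate M a <> mate N a.
  have [/existsP[a /eqP]|/existsPn h] := boolP [exists a, mate M a != mate N a].
    by exists a.
  by case: MN; apply: mate_inj => a; have := h a; rewrite negbK => /eqP.
exists a.
have K1 := mateK M a; have K2 := mateK N a; have K3 := mateK M (mate N a).
have K4 := mateK N (mate M a); have K5 := mateK N (mate M (mate N a)).
have n1 := mate_neq M a; have n2 := mate_neq N a; have n4 := mate_neq M (mate N a).
(* For n at least 8, two disjoint edges can be extended while avoiding a third matching; n = 6 is
   settled by listing all six points. *)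
have [n8|n7] := leqP 8 n.
  have aMP : mate M a <> mate P a by move=> e; have := line_agree h2 e; ground_congruence.
  (* Every edge of N outside M touches {a, M a}. Otherwise a matching through {a, M a} and {c, N c}
     that avoids P elsewhere meets M and N; by [line_agree] P contains neither edge, so it misses
     P. *)
  have key c : mate M c <> mate N c ->
    [\/ c = a, c = mate M a, mate N c = a | mate N c = mate M a].
    move=> cMN.
    have cNP : mate N c <> mate P c by move=> e; have := line_agree h3 e; ground_congruence.
    at4 c a (mate M a) (mate N a) (mate N (mate M a)) e.
    - by constructor 1.
    - by constructor 2.
    - by constructor 3; ground_congruence.
    - by constructor 4; ground_congruence.
    have Kc := mateK N c.
    have [||||Q [Qa Qc Qn]] := @extend_two_edges M N P a c n8; try ground_congruence.
    have : ~~ pm_adj Q P by apply: h1; apply/pm_adjPn; [exists a | exists c].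
    case/pm_adjPn=> y Qy; have L1 := mateK Q a; have L2 := mateK Q c.
    have L3 := mateK P a; have L4 := mateK P c; have L5 := mateK P y.
    exfalso; at4 y a (mate M a) c (mate N c) e; try ground_congruence.
    by apply: (Qn y).
  have e0 : mate N (mate M a) = mate M (mate N a).
    have [] := key (mate M (mate N a)); ground_congruence.
  split=> // x xa xMa xNa xMNa; have [//|/eqP xMN] := eqVneq (mate M x) (mate N x).
  have Kx := mateK N x; have [] := key x xMN; ground_congruence.
(* M and N share the edge at [x], so they differ only on the remaining four points. *)
have [x ex] := elimT (pm_adjPn _ _) mMN.
have K6 := mateK M x; have K7 := mateK N x; have n3 := mate_neq M x.
have U : uniq [:: x; mate M x; a; mate M a; mate N a; mate M (mate N a)].
  rewrite /= !inE !negb_or; repeat (apply/andP; split=> //); apply/eqP; ground_congruence.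
have full y : y \in [:: x; mate M x; a; mate M a; mate N a; mate M (mate N a)].
  have n6 : n = 6.
    apply/eqP; rewrite eqn_leq n_ge6 andbT -ltnS ltn_neqAle -ltnS n7 andbT.
    by apply: contraNneq n_even => /(congr1 odd) ->.
  have [||_ ->] := @uniq_min_size _ _ (enum 'I_n) U; last by rewrite mem_enum.
    by move=> z _; rewrite mem_enum.
  by rewrite size_enum_ord; apply: eq_leq.
have e0 : mate N (mate M a) = mate M (mate N a).
  have n5 := mate_neq N (mate M a); have := full (mate N (mate M a)); rewrite !inE.
  by case/or4P=> [/eqP|/eqP|/eqP|/or3P[]/eqP]; ground_congruence.
split=> // y ? ? ? ?; have := full y; rewrite !inE.
by case/or4P=> [/eqP|/eqP|/eqP|/or3P[]/eqP]; ground_congruence.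
Qed.

End Switch.

(** * Single common edges expressed through the graph *)

Section Automorphism.
Context {n : nat}.
Hypotheses (n_even : ~~ odd n) (n_ge6 : 6 <= n).
Implicit Types (M N P Q R : pm_vertex n) (x y z : 'I_n).

Lemma switch_adj M N Q : switch M N -> ~~ pm_adj Q M ->
  (pm_adj Q N <-> forall x, mate Q x = mate M x -> mate M x <> mate N x).
Proof.
move=> s QM; split=> [/pm_adjP QN x e1 e2|h]; first by apply: (QN x); congruence.
apply/negPn/negP => QN; have [x [e1 e2]] := switch_common_edge s QM QN.
exact: h e1 e2.
Qed.

Lemma fresh_point (s : seq 'I_n) : size s < 6 -> exists x, x \notin s.
Proof.
move=> s6; have [/existsP[x xs]|/existsPn h] := boolP [exists x, x \notin s].
  by exists x.
have : size (enum 'I_n) <= size s.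
  by apply: uniq_leq_size (enum_uniq _) _ => x _; have := h x; rewrite negbK.
by rewrite size_enum_ord leqNgt (leq_trans s6 n_ge6).
Qed.

Definition unique_common_edge M Q Q' x := forall y,
  (mate Q y = mate M y <-> y = x \/ y = mate M x) /\
  (mate Q' y = mate M y <-> y = x \/ y = mate M x).

(** Only adjacency and switches occur, so automorphisms preserve it. By [switch_adj], edges shared
    with M lie in both switched pairs; the conditions on N1 and N2 make these pairs different. *)
Definition same_single_trace M Q Q' := [/\ ~~ pm_adj Q M, ~~ pm_adj Q' M &
  exists N1 N2, [/\ switch M N1, switch M N2, N1 <> N2, ~ switch N1 N2 &
    [/\ pm_adj Q N1, pm_adj Q N2, pm_adj Q' N1 & pm_adj Q' N2]]].

Lemma unique_common_edge_trace M Q Q' x :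
  unique_common_edge M Q Q' x -> same_single_trace M Q Q'.
Proof.
move=> h; have [Qx Q'x] := h x.
have QM : ~~ pm_adj Q M by apply/pm_adjPn; exists x; apply/Qx; left.
have QM' : ~~ pm_adj Q' M by apply/pm_adjPn; exists x; apply/Q'x; left.
have [z] := @fresh_point [:: x; mate M x] isT.
rewrite !inE negb_or => /andP[/eqP zx /eqP zMx].
have [w] := @fresh_point [:: x; mate M x; z; mate M z] isT.
rewrite !inE !negb_or => /and4P[/eqP wx /eqP wMx /eqP wz /eqP wMz].
(* The common edge is switched with each of two further edges of M. *)
have [N1 s1 N1x] := exists_switch zx zMx; have [N2 s2 N2x] := exists_switch wx wMx.
have [a1 b1 c1] := s1; have [a2 b2 c2] := s2; rewrite N1x N2x in b1 c1 b2 c2.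
have adjN N z' q : switch_at x M N -> ~~ pm_adj q M -> mate N x = z' ->
    (forall y, mate q y = mate M y <-> y = x \/ y = mate M x) -> pm_adj q N.
  move=> s qM Nx hq; apply/(switch_adj _ qM); first by exists x.
  move=> y /hq [->|->]; have [? b _] := s => //.
  by rewrite b mateK; have := mateK M (mate N x); have := mateK M x; congruence.
split=> //; exists N1, N2; split.
- by exists x.
- by exists x.
- by congruence.
- case=> a [_ _ out].
  have K1 := mateK M x; have K2 := mateK M z; have K3 := mateK M w.
  have n1 := mate_neq M x; have n2 := mate_neq M z; have n3 := mate_neq M w.
  have K4 := mateK N1 x; have K5 := mateK N2 x.
  have K6 := mateK N1 (mate M x); have K7 := mateK N2 (mate M x).
  have e1 : mate M z = mate N2 z by apply: c2; ground_congruence.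
  have e2 : mate M (mate M z) = mate N2 (mate M z) by apply: c2; ground_congruence.
  have e3 : mate M w = mate N1 w by apply: c1; ground_congruence.
  have e4 : mate M (mate M w) = mate N1 (mate M w) by apply: c1; ground_congruence.
  have U : uniq [:: x; mate M x; z; mate M z; w; mate M w].
    rewrite /= !inE !negb_or; repeat (apply/andP; split=> //); apply/eqP; ground_congruence.
  (* N1 and N2 differ at all six points, whereas a switch changes only four. *)
  have : size [:: x; mate M x; z; mate M z; w; mate M w] <=
         size [:: a; mate N1 a; mate N2 a; mate N1 (mate N2 a)].
    apply: uniq_leq_size U _ => y yl; apply/negPn/negP => hy.
    have e : mate N1 y = mate N2 y.
      by move: hy; rewrite !inE !negb_or => /and4P[/eqP ? /eqP ? /eqP ? /eqP ?]; apply: out.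
    by move: yl; rewrite !inE => /or4P[/eqP ey|/eqP ey|/eqP ey|/or3P[]/eqP ey];
      rewrite ey in e; ground_congruence.
  by [].
split; [apply: adjN s1 QM N1x _ | apply: adjN s2 QM N2x _ |
        apply: adjN s1 QM' N1x _ | apply: adjN s2 QM' N2x _] => y; by have [] := h y.
Qed.

Lemma trace_unique_common_edge M Q Q' :
  same_single_trace M Q Q' -> exists x, unique_common_edge M Q Q' x.
Proof.
case=> QM QM' [N1 [N2 [s1 s2 N12 nsw [a1 a2 a1' a2']]]].
have t1 := proj1 (switch_adj s1 QM) a1; have t2 := proj1 (switch_adj s2 QM) a2.
have t1' := proj1 (switch_adj s1 QM') a1'; have t2' := proj1 (switch_adj s2 QM') a2'.
have [x Qx] := elimT (pm_adjPn _ _) QM; have [x' Q'x'] := elimT (pm_adjPn _ _) QM'.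
have [x1 x2] := (t1 x Qx, t2 x Qx).
have [_ b1 out1] := switch_everywhere s1 x1; have [_ b2 out2] := switch_everywhere s2 x2.
have K1 := mateK M x; have K2 := mateK M (mate N1 x); have K3 := mateK M (mate N2 x).
have K4 := mateK N1 x; have K5 := mateK N2 x; have K6 := mateK Q x.
have K7 := mateK N1 (mate M x); have K8 := mateK N2 (mate M x).
(* Another point moved by both switches would make them act on the same two edges of M; then N1 and
   N2 would be equal or switches of each other. *)
have key y : mate M y <> mate N1 y -> mate M y <> mate N2 y -> y = x \/ y = mate M x.
  move=> y1 y2; have [|/eqP yx] := eqVneq y x; first by left.
  have [|/eqP yMx] := eqVneq y (mate M x); first by right.
  have m1 : y = mate N1 x \/ y = mate M (mate N1 x).
    have [|/eqP h1] := eqVneq y (mate N1 x); first by left.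
    have [|/eqP h2] := eqVneq y (mate M (mate N1 x)); first by right.
    by case: y1; apply: out1.
  have m2 : y = mate N2 x \/ y = mate M (mate N2 x).
    have [|/eqP h1] := eqVneq y (mate N2 x); first by left.
    have [|/eqP h2] := eqVneq y (mate M (mate N2 x)); first by right.
    by case: y2; apply: out2.
  have [e|/eqP ne] := eqVneq (mate N1 x) (mate N2 x).
    by case: N12; apply: switch_det s1 s2 e x1.
  case: nsw; exists x; have e : mate N2 x = mate M (mate N1 x).
    by case: m1; case: m2; ground_congruence.
  split=> //; first by ground_congruence.
  move=> z zx z1 z2 z3; transitivity (mate M z).
    by symmetry; apply: out1; ground_congruence.
  by apply: out2; ground_congruence.
have Q'x : mate Q' x = mate M x.
  have K9 := mateK Q' x'; have K10 := mateK M x'.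
  have [] := key x' (t1' _ Q'x') (t2' _ Q'x'); ground_congruence.
have K9 := mateK Q' x.
exists x => y; split; (split; first by [move=> h; apply: key; auto]); by case=> ->; ground_congruence.
Qed.

(** R contains {x, y} and avoids both M and Q elsewhere; it links two arbitrary matchings through
    that edge. *)
Lemma exists_single_trace M Q x y : x <> y -> mate M x = y -> mate Q x = y ->
  exists R, unique_common_edge M R R x /\ unique_common_edge R M Q x.
Proof.
move=> xy Mx Qx; have [R [Rx Rn]] := extend_edge n_even n_ge6 M Q xy.
have KM := mateK M x; have KR := mateK R x; have KQ := mateK Q x.
have agree z : mate R z = mate M z \/ mate R z = mate Q z -> z = x \/ z = y.
  move=> e; have [|/eqP zx] := eqVneq z x; first by left.
  have [|/eqP zy] := eqVneq z y; first by right.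
  by have [h1 h2] := Rn z zx zy; case: e.
exists R; rewrite /unique_common_edge Mx Rx; split=> z.
  by split; (split; [by move=> e; apply: agree; left | case=> ->; ground_congruence]).
split; (split; last by case=> ->; ground_congruence); move=> e; apply: agree.
  by left.
by right.
Qed.

(** * From graph automorphisms to permutations of edges and points *)

Definition adj_auto (f g : pm_vertex n -> pm_vertex n) :=
  [/\ cancel f g, cancel g f & forall M N, pm_adj (f M) (f N) = pm_adj M N].

Lemma adj_auto_sym f g : adj_auto f g -> adj_auto g f.
Proof. by move=> [fK gK h]; split=> // M N; rewrite -h !gK. Qed.

Lemma adj_auto_switch f g M N : adj_auto f g -> switch M N -> switch (f M) (f N).
Proof.
move=> [fK gK h] /(switch_line n_ge6)[P [[MN MP NP] [aMN aMP aNP] [t1 t2 t3]]].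
apply: (line_switch n_even n_ge6 (P := f P)); split.
- by split=> /(can_inj fK).
- by rewrite !h.
by split=> Q; rewrite -[Q]gK !h; auto.
Qed.

Lemma adj_auto_switchE f g M N : adj_auto f g -> switch (f M) (f N) -> switch M N.
Proof.
move=> fg /(adj_auto_switch (adj_auto_sym fg)); by have [fK _ _] := fg; rewrite !fK.
Qed.

Lemma adj_auto_trace f g M Q Q' : adj_auto f g ->
  same_single_trace M Q Q' -> same_single_trace (f M) (f Q) (f Q').
Proof.
move=> fg [QM QM' [N1 [N2 [s1 s2 N12 nsw [a1 a2 a1' a2']]]]].
have [fK gK h] := fg; split; rewrite ?h //; exists (f N1), (f N2); split.
- exact: adj_auto_switch fg s1.
- exact: adj_auto_switch fg s2.
- by move/(can_inj fK).
- by move/(adj_auto_switchE fg).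
by rewrite !h.
Qed.

(* If M and M' both contain xy, some R meets each of them in xy only; the
   images of M, R share a single edge, and so do those of R, M', and the two
   edges coincide because R has the same trace on both. *)
Lemma edge_image f g x y : adj_auto f g -> x <> y ->
  exists x' y', x' <> y' /\ forall M, mate M x = y -> mate (f M) x' = y'.
Proof.
move=> fg xy; have [M0 M0x] := exists_mate n_even n_ge6 xy.
have [R0 [u0 _]] := exists_single_trace xy M0x M0x.
have t0 := unique_common_edge_trace u0.
have [x' h0] := trace_unique_common_edge (adj_auto_trace fg t0).
exists x', (mate (f M0) x'); split; first exact/not_eq_sym/mate_neq.
move=> M Mx; have [R [uR uRM]] := exists_single_trace xy M0x Mx.
have uR0 : unique_common_edge M0 R0 R x.
  by move=> y'; have [? _] := u0 y'; have [? _] := uR y'.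
have [x1 h1] := trace_unique_common_edge (adj_auto_trace fg (unique_common_edge_trace uR0)).
have [x2 h2] := trace_unique_common_edge (adj_auto_trace fg (unique_common_edge_trace uRM)).
have eR0 : mate (f R0) x' = mate (f M0) x' by have [a _] := h0 x'; apply/a; left.
have eR : mate (f R) x' = mate (f M0) x' by have [a b] := h1 x'; apply/b/a.
by have [a b] := h2 x'; rewrite -eR; apply/b/a.
Qed.

(** Going forth by [f] and back by [g], every matching through {x, y} contains {x2, y2}; by
    [exists_mate_avoiding] the two edges coincide. *)
Lemma edge_image_iff f g x y : adj_auto f g -> x <> y ->
  exists x' y', x' <> y' /\ forall M, mate M x = y <-> mate (f M) x' = y'.
Proof.
move=> fg xy; have [x' [y' [xy' h]]] := edge_image fg xy.
have [x2 [y2 [xy2 h2]]] := edge_image (adj_auto_sym fg) xy'.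
exists x', y'; split=> // M; split; first exact: h.
move=> /h2; have [fK _ _] := fg; rewrite fK => e.
have [c1|] := boolP ((x2 == x) && (y2 == y)).
  by move: c1 => /andP[/eqP <- /eqP <-].
have [c2 _|c2 c1] := boolP ((x2 == y) && (y2 == x)).
  by move: c2 => /andP[/eqP ey /eqP ex]; rewrite -ey -ex -e mateK.
have [||P [Px Px2]] := @exists_mate_avoiding _ n_even n_ge6 x y x2 y2 xy.
- by case=> ex ey; rewrite ex ey !eqxx in c1.
- by case=> ex ey; rewrite ex ey !eqxx in c2.
by case: Px2; rewrite -(h2 _ (h _ Px)) fK.
Qed.

Definition edge_maps f x y x' y' :=
  [/\ x <> y, x' <> y' & forall M : pm_vertex n, mate M x = y <-> mate (f M) x' = y'].

Lemma edge_maps_symr f x y a b : edge_maps f x y a b -> edge_maps f x y b a.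
Proof.
move=> [xy ab h]; split=> //; first exact: not_eq_sym.
by move=> M; split=> [/h <-|e]; [apply: mateK | apply/h; rewrite -e mateK].
Qed.

Lemma edge_maps_unique f x y z a b : edge_maps f x y a b -> edge_maps f x z a b -> y = z.
Proof.
move=> [xy _ h1] [_ _ h2]; have [M Mx] := exists_mate n_even n_ge6 xy.
by have /h2 := proj1 (h1 M) Mx; congruence.
Qed.

(** If the images were disjoint, some matching would contain both, and its preimage would give [x]
    two partners. *)
Lemma edge_maps_meet f g x y z a b c d : adj_auto f g ->
  edge_maps f x y a b -> edge_maps f x z c d -> y <> z ->
  [\/ a = c, a = d, b = c | b = d].
Proof.
move=> fg [xy ab h1] [xz cd h2] yz.
have [|/eqP ac] := eqVneq a c; first by constructor 1.
have [|/eqP ad] := eqVneq a d; first by constructor 2.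
have [|/eqP bc] := eqVneq b c; first by constructor 3.
have [|/eqP bd] := eqVneq b d; first by constructor 4.
have U : uniq [:: a; b; c; d].
  rewrite /= !inE !negb_or; repeat (apply/andP; split=> //); exact/eqP.
have [Q [Qa Qc]] := exists_two_mates n_even n_ge6 U.
have [_ gK _] := fg; case: yz.
have <- : mate (g Q) x = y by apply/h1; rewrite gK.
by apply/h2; rewrite gK.
Qed.

Definition point_maps f x a := forall y, x <> y -> exists b, edge_maps f x y a b.

(* Images of edges at x pairwise intersect; since there are more than three of
   them they form a star rather than a triangle. *)
Lemma exists_point_image f g x : adj_auto f g -> exists a, point_maps f x a.
Proof.
move=> fg; have E y : x <> y -> exists a b, edge_maps f x y a b.
  by move=> xy; have [a [b [? ?]]] := edge_image_iff fg xy; exists a, b.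
have [y1] := @fresh_point [:: x] isT; rewrite !inE eq_sym => /eqP xy1.
have [y2] := @fresh_point [:: x; y1] isT; rewrite !inE negb_or.
move=> /andP[/eqP /nesym xy2 /eqP y21].
have [a [b [c [e1 e2]]]] : exists a b c, edge_maps f x y1 a b /\ edge_maps f x y2 a c.
  have [a [b e1]] := E y1 xy1; have [c [d e2]] := E y2 xy2.
  have [e|e|e|e] := edge_maps_meet fg e1 e2 (not_eq_sym y21); rewrite -e in e2.
  - by exists a, b, d.
  - by exists a, b, c; split=> //; apply: edge_maps_symr.
  - by exists b, a, d; split=> //; apply: edge_maps_symr.
  - by exists b, a, c; split; apply: edge_maps_symr.
have bc : b <> c by move=> e; apply: y21; rewrite -e in e2; apply: edge_maps_unique e2 e1.
exists a => y xy; have [d [e e3]] := E y xy.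
have [yy1|/eqP yy1] := eqVneq y y1; first by exists b; rewrite yy1.
have [yy2|/eqP yy2] := eqVneq y y2; first by exists c; rewrite yy2.
have [da|/eqP da] := eqVneq d a; first by exists e; rewrite -da.
have [ea|/eqP ea] := eqVneq e a; first by exists d; rewrite -ea; apply: edge_maps_symr.
have {d e da ea} e3 : edge_maps f x y b c.
  have i1 := edge_maps_meet fg e3 e1 yy1; have i2 := edge_maps_meet fg e3 e2 yy2.
  have e3' := edge_maps_symr e3.
  by case: i1 => i1; case: i2 => i2; congruence.
(* The image of a fourth edge must meet all three sides of the triangle a, b, c, so it is one of
   them, against [edge_maps_unique]. *)
have [w] := @fresh_point [:: x; y; y1; y2] isT; rewrite !inE !negb_or.
move=> /and4P[/eqP /nesym xw /eqP wy /eqP wy1 /eqP wy2].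
have [d [e e4]] := E w xw.
have n1 := edge_maps_meet fg e4 e1 wy1; have n2 := edge_maps_meet fg e4 e2 wy2.
have n3 := edge_maps_meet fg e4 e3 wy.
have e4' := edge_maps_symr e4; have [_ de _] := e4.
have u1 p q : edge_maps f x w p q -> (p = a /\ q = b) -> False.
  by move=> h [ep eq]; rewrite ep eq in h; apply: wy1; apply: edge_maps_unique h e1.
have u2 p q : edge_maps f x w p q -> (p = a /\ q = c) -> False.
  by move=> h [ep eq]; rewrite ep eq in h; apply: wy2; apply: edge_maps_unique h e2.
have u3 p q : edge_maps f x w p q -> (p = b /\ q = c) -> False.
  by move=> h [ep eq]; rewrite ep eq in h; apply: wy; apply: edge_maps_unique h e3.
have [_ ab _] := e1; have [_ ac _] := e2.
exfalso; case: n1 => n1; case: n2 => n2; case: n3 => n3;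
  solve [ground_congruence | by apply: (u1 _ _ e4) | by apply: (u1 _ _ e4')
        | by apply: (u2 _ _ e4) | by apply: (u2 _ _ e4')
        | by apply: (u3 _ _ e4) | by apply: (u3 _ _ e4')].
Qed.

(** The point [b] lies on every edge at [x], and two such edges share only [x]. *)
Lemma point_maps_inverse f g x a b : adj_auto f g ->
  point_maps f x a -> point_maps g a b -> b = x.
Proof.
move=> [fK gK _] fx ga.
have key y : x <> y -> b = x \/ b = y.
  move=> xy; have [a' [_ aa' h1]] := fx y xy; have [b' [_ bb' h2]] := ga a' aa'.
  have h M : mate M x = y <-> mate M b = b'.
    by have := h2 (f M); rewrite fK => h2M; split=> [/h1/h2M|/h2M/h1].
  have [|/eqP bx] := eqVneq b x; first by left.
  have [|/eqP by_] := eqVneq b y; first by right.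
  have [||P [Px Pb]] := @exists_mate_avoiding _ n_even n_ge6 x y b b' xy.
  - by case.
  - by case.
  by case: Pb; apply/h.
have [y] := @fresh_point [:: x] isT; rewrite !inE eq_sym => /eqP xy.
have [z] := @fresh_point [:: x; y] isT; rewrite !inE negb_or.
move=> /andP[/eqP /nesym xz /eqP zy].
have [//|e1] := key y xy; have [//|e2] := key z xz; congruence.
Qed.

Lemma adj_auto_perm f g : adj_auto f g ->
  exists s : {perm 'I_n}, forall M x, mate (f M) (s x) = s (mate M x).
Proof.
move=> fg.
have [s hs] := fin_all_exists (fun x => exists_point_image x fg).
have [t ht] := fin_all_exists (fun x => exists_point_image x (adj_auto_sym fg)).
have sK : cancel s t by move=> x; apply: (point_maps_inverse fg (hs x) (ht _)).
exists (perm (can_inj sK)) => M x; rewrite !permE.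
have xy := not_eq_sym (mate_neq M x).
have [b [_ sb h1]] := hs x _ xy; have [c [_ sc h2]] := hs _ _ (not_eq_sym xy).
have Mb := proj1 (h1 M) erefl; have Mc := proj1 (h2 M) (mateK M x).
(* The edge {x, M x} has images {s x, b} and {s (M x), c}, read off from its two ends. Both lie in
   the same matchings, so they agree. *)
have [e|/eqP bs] := eqVneq b (s (mate M x)); first by rewrite Mb.
have ss : s (mate M x) <> s x by move=> /(can_inj sK); apply: mate_neq.
have [||P [Px Pb]] := @exists_mate_avoiding _ n_even n_ge6 (s x) b (s (mate M x)) c sb.
- by case.
- by case=> ? _; congruence.
have [_ gK _] := fg; case: Pb; rewrite -[P]gK; apply/h2.
have -> : mate M x = mate (g P) x by symmetry; apply/h1; rewrite gK.
by rewrite mateK.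
Qed.

End Automorphism.

(** * Odd permutation groups transitive on matchings *)

Lemma matching_on_extend (T : finType) (D E : {set T}) p :
  ~~ odd #|D| -> E \subset D -> matching_on E p ->
  exists q, matching_on D q /\ {in E, q =1 p}.
Proof.
move=> Dev ED pE; have [|r rD] := @even_set_matching _ (D :\: E).
  by rewrite cardsD (setIidPr ED) oddB ?subset_leq_card // (negbTE (even_matching_on pE)) addbF.
have dE : [disjoint E & D :\: E].
  by rewrite -setI_eq0 setIDA setDIl setDv set0I.
have := matching_on_glue dE pE rD; rewrite -{1}(setIidPr ED) setID => g.
by eexists; split; [exact: g | move=> x xE /=; rewrite xE].
Qed.

Section OddGroup.
Local Open Scope group_scope.

(* If an orbit A and its complement B in D both had at least two points, a
   matching with a single edge between A and B could not be moved to one with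
   two such edges. *)
Lemma odd_group_fixed_point (T : finType) (K : {group {perm T}}) (D : {set T}) :
  odd #|K| -> (forall s x, s \in K -> x \in D -> s x \in D) ->
  ~~ odd #|D| -> D != set0 ->
  (forall p q, matching_on D p -> matching_on D q ->
     exists2 s, s \in K & forall x, x \in D -> q (s x) = s (p x)) ->
  exists2 c, c \in D & forall s : {perm T}, s \in K -> s c = c.
Proof.
move=> Kodd KD Dev /set0Pn[x xD] Ktr.
pose A := orbit 'P K x; pose B := D :\: A.
have memA s y : s \in K -> (s y \in A) = (y \in A).
  by move=> sK; apply: (orbit_transl (to := 'P)); exact: (mem_orbit 'P y sK).
have memB s y : s \in K -> y \in B -> s y \in B.
  by move=> sK; rewrite !inE memA // => /andP[-> /(KD _ _ sK)].
have xA : x \in A by apply: orbit_refl.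
have AD : A \subset D by apply/subsetP => _ /orbitP[s sK <-]; apply: KD.
have Aodd : odd #|A| by apply: dvdn_odd (dvdn_orbit _ _ _) Kodd.
have Bodd : odd #|B|.
  rewrite cardsD (setIidPr AD) oddB ?subset_leq_card //.
  by rewrite Aodd (negbTE Dev).
have [A1|A2] := leqP #|A| 1.
  exists x => // s sK; have : s x \in A by rewrite memA.
  have /card_le1_eqP h := A1; exact: h.
have [B1|B2] := leqP #|B| 1.
  have [c cB] : exists c, c \in B by apply/card_gt0P; case: #|B| Bodd.
  exists c; first by move: cB; rewrite inE => /andP[].
  by move=> s sK; have /card_le1_eqP h := B1; apply: h => //; apply: memB.
have BD : B \subset D by apply: subsetDl.
have AB y : y \in A -> y \notin B by rewrite inE => ->.
(* Since A is odd, all of it but [x] can be matched internally. *)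
have [p [pD pA]] : exists p, matching_on D p /\ forall y, y \in A -> p y \in B -> y = x.
  have [|r rA] := @even_set_matching _ (A :\ x).
    by have := cardsD1 x A; rewrite xA => e; rewrite e /= in Aodd.
  have [p [pD pr]] := matching_on_extend Dev (subset_trans (subD1set A x) AD) rA.
  exists p; split=> // y yA py; have [//|yx] := eqVneq y x.
  have yAx : y \in A :\ x by rewrite !inE yx.
  have [] := rA y yAx; rewrite -pr // !inE => /andP[_ /AB]; by rewrite py.
have /card_gt1P[a1 [a2 [a1A a2A a12]]] := A2.
have /card_gt1P[b1 [b2 [b1B b2B b12]]] := B2.
have ab a b : a \in A -> b \in B -> a <> b.
  by move=> aA bB e; have := AB a aA; rewrite e bB.
have [q [qD q1 q2]] : exists q, [/\ matching_on D q, q a1 = b1 & q a2 = b2].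
  have dd : [disjoint [set a1; b1] & [set a2; b2]].
    rewrite -setI_eq0; apply/eqP/setP => z; rewrite !inE; apply/negP.
    case/andP=> /orP[]/eqP-> /orP[]/eqP.
    - exact/eqP.
    - exact: ab.
    - exact/nesym/ab.
    - exact/eqP.
  have m1 := matching_on_pair (ab _ _ a1A b1B); have m2 := matching_on_pair (ab _ _ a2A b2B).
  have [|q [qD qE]] := matching_on_extend Dev _ (matching_on_glue dd m1 m2).
    rewrite !subUset !sub1set (subsetP AD _ a1A) (subsetP AD _ a2A).
    by rewrite (subsetP BD _ b1B) (subsetP BD _ b2B).
  exists q; split=> //; rewrite qE !inE ?eqxx ?orbT //.
  by rewrite (eq_sym a2) (negbTE a12) (introF eqP (ab _ _ a2A b1B)).
have [s sK sq] := Ktr p q pD qD.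
(* [s^-1] carries [q] to [p] and preserves A and B, so each edge of [q] between A and B goes to the
   only such edge of [p]. *)
have key a b : a \in A -> b \in B -> q a = b -> s^-1 a = x.
  move=> aA bB qab; have sVK : s^-1 \in K by rewrite groupV.
  have ysA : s^-1 a \in A by rewrite memA.
  apply: pA => //; have := sq _ (subsetP AD _ ysA); rewrite permKV qab => e.
  by rewrite -[p _](permK s) -e memB.
case/eqP: a12; apply: (@perm_inj _ s^-1).
by rewrite (key a1 b1) // (key a2 b2).
Qed.

Lemma no_regular_perm_group n (H : {group {perm 'I_n}}) : ~~ odd n -> 6 <= n ->
  (forall M N : pm_vertex n, exists2 s, s \in H &
     forall x, mate N (s x) = s (mate M x)) ->
  (forall (M : pm_vertex n) s, s \in H ->
     (forall x, mate M (s x) = s (mate M x)) -> s = 1) -> False.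
Proof.
move=> n_even n_ge6 Htr Hreg.
have mateT p : matching_on [set: 'I_n] p -> exists M : pm_vertex n, mate M =1 p.
  by move=> h; apply: mate_surj => x; have [_ ? ?] := h x (in_setT x).
have cardT : #|[set: 'I_n]| = n by rewrite cardsT card_ord.
have Hodd : odd #|H|.
  apply/negPn/negP => Hev; have [//||s sH os] := @Cauchy _ 2 H; first by rewrite dvdn2.
  have ss x : s (s x) = x by rewrite -permM -expg2 -os expg_order perm1.
  (* An involution pairs the points it moves; matching its fixed points among themselves gives an
     invariant matching. *)
  pose D := [set x | s x != x].
  have sD : matching_on D s.
    move=> x; rewrite !inE ss => sx; split=> //; last exact/eqP.
    by rewrite eq_sym.
  have [|q [qT qD]] := matching_on_extend _ (subsetT D) sD; first by rewrite cardT.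
  have [M Mq] := mateT q qT.
  have /eqP := os; rewrite (Hreg M s sH) ?order1 // => x; rewrite !Mq.
  have [xD|xD] := boolP (x \in D).
    by have [sxD _ _] := sD x xD; rewrite !qD.
  have qxD : q x \notin D.
    apply: contra xD => qxD; have [_ _ qq] := qT x (in_setT x).
    by rewrite -qq qD //; have [] := sD _ qxD.
  by move: xD qxD; rewrite !inE !negbK => /eqP-> /eqP->.
have [a _ aH] : exists2 a, a \in [set: 'I_n] & forall s : {perm 'I_n}, s \in H -> s a = a.
  apply: odd_group_fixed_point => //; rewrite ?cardT //.
    by rewrite -card_gt0 cardT (leq_trans _ n_ge6).
  move=> p q /mateT[M Mp] /mateT[N Nq]; have [s sH h] := Htr M N.
  by exists s => // x _; rewrite -Nq h Mp.
pose fixes b c := [/\ c <> a, c <> b & forall s : {perm 'I_n}, s \in H -> s b = b -> s c = c].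
have stabE b s : (s \in 'C_H[b | 'P]) = (s \in H) && (s b == b).
  by rewrite inE (sameP astab1P eqP).
have fixes_ex b : b <> a -> exists c, fixes b c.
  move=> ba; pose K := ('C_H[b | 'P])%G; pose D := ~: [set a; b].
  have KP s : (s \in K) = (s \in H) && (s b == b) by apply: stabE.
  have cD : #|D| = n - 2.
    by rewrite cardsCs setCK card_ord cards2 (introF eqP (nesym ba)).
  have [|||||c cD' cK] := @odd_group_fixed_point _ K D.
  - by apply: dvdn_odd (cardSg (subsetIl _ _)) Hodd.
  - move=> s x; rewrite KP !inE => /andP[sH /eqP sb]; apply: contra.
    by rewrite -{1}(aH s sH) -{1}sb !(inj_eq perm_inj).
  - by rewrite cD oddB ?addbF // (leq_trans _ n_ge6).
  - by rewrite -card_gt0 cD subn_gt0 (leq_trans _ n_ge6).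
  - move=> p q pD qD.
    (* Adding the edge {a, b} to matchings of D shows that the stabiliser of [b] is transitive on
       them: an element fixing [a] and respecting this edge fixes [b]. *)
    have ext r : matching_on D r -> exists M : pm_vertex n, mate M a = b /\ {in D, mate M =1 r}.
      move=> rD; have dE : [disjoint [set a; b] & D] by rewrite -setI_eq0 setICr.
      have := matching_on_glue dE (matching_on_pair (nesym ba)) rD; rewrite setUCr.
      move=> /mateT[M Mr]; exists M; split=> [|x xD]; rewrite Mr !inE ?eqxx //.
      by move: xD; rewrite !inE => /negbTE->.
    have [M [Ma Mp]] := ext p pD; have [N [Na Nq]] := ext q qD.
    have [s sH sMN] := Htr M N.
    have sb : s b = b by have := sMN a; rewrite aH // Na Ma.
    exists s; first by rewrite KP sH sb eqxx.
    move=> x xD; rewrite -Mp // -sMN Nq // !inE.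
    by rewrite -{1}(aH s sH) -{1}sb !(inj_eq perm_inj); move: xD; rewrite !inE.
  exists c; split.
  - by move=> e; move: cD'; rewrite e !inE eqxx.
  - by move=> e; move: cD'; rewrite e !inE eqxx orbT.
  by move=> s sH sb; apply: cK; rewrite KP sH sb eqxx.
(* Carrying a matching through {a, b} to one through {a, c} puts [c] in the orbit of [b]. The
   stabilisers thus have equal order, and one contains the other. *)
have fixes_sym b c : b <> a -> fixes b c -> fixes c b.
  move=> ba [ca cb h]; split=> //; first exact: nesym.
  have [M Ma] := exists_mate n_even n_ge6 (nesym ba).
  have [N Na] := exists_mate n_even n_ge6 (nesym ca).
  have [t tH tMN] := Htr M N.
  have tb : t b = c by have := tMN a; rewrite aH // Ma Na.
  have sub : 'C_H[b | 'P] \subset 'C_H[c | 'P].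
    by apply/subsetP => s; rewrite !stabE => /andP[sH /eqP sb]; rewrite sH h ?eqxx.
  have oe : orbit 'P H b = orbit 'P H c.
    by apply/esym/orbit_eqP; rewrite -tb; exact: (mem_orbit 'P b tH).
  have e : 'C_H[b | 'P] = 'C_H[c | 'P].
    apply/eqP; rewrite eqEcard sub /=.
    have := card_orbit_stab 'P H b; rewrite -(card_orbit_stab 'P H c) oe => /eqP.
    rewrite eqn_pmul2l; first by move=> /eqP->.
    by apply/card_gt0P; exists c; apply: orbit_refl.
  move=> s sH sc; have : s \in 'C_H[b | 'P] by rewrite e stabE sH sc eqxx.
  by rewrite stabE => /andP[_ /eqP].
(* Some element carries a matching through {a, b}, {c, d} to one through {a, b}, {c, c'}. It fixes
   b, hence c and c', so d = c'. *)
have fixes_uniq b c c' : b <> a -> fixes b c -> fixes b c' -> c = c'.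
  move=> ba [ca cb h] [c'a c'b h']; have [//|/eqP cc'] := eqVneq c c'.
  have [d] := @fresh_point _ n_ge6 [:: a; b; c; c'] isT; rewrite !inE !negb_or.
  move=> /and4P[/eqP da /eqP db /eqP dc /eqP dc'].
  have [|M [Ma Mc]] := @exists_two_mates _ n_even n_ge6 a b c d.
    rewrite /= !inE !negb_or; repeat (apply/andP; split=> //); apply/eqP; congruence.
  have [|N [Na Nc]] := @exists_two_mates _ n_even n_ge6 a b c c'.
    rewrite /= !inE !negb_or; repeat (apply/andP; split=> //); apply/eqP; congruence.
  have [s sH sMN] := Htr M N.
  have sb : s b = b by have := sMN a; rewrite aH // Na Ma.
  have := sMN c; rewrite (h s sH sb) Nc Mc -{1}(h' s sH sb) => /perm_inj; congruence.
(* The condition [b <> a] sits inside the existential so that a choice function on all points can be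
   taken. *)
have fixes_total b : exists c, b <> a -> fixes b c.
  have [->|/eqP ba] := eqVneq b a; first by exists a.
  by have [c hc] := fixes_ex b ba; exists c.
have [c hc] := fin_all_exists fixes_total.
have : matching_on (~: [set a]) c.
  move=> b; rewrite !inE => /eqP ba; have [ca cb _] := hc b ba; split=> //; first exact/eqP.
  exact: fixes_uniq ca (hc _ ca) (fixes_sym _ _ ba (hc b ba)).
move/even_matching_on; rewrite cardsCs setCK card_ord cards1 oddB ?addbT ?negbK ?(negbTE n_even) //.
exact: leq_trans n_ge6.
Qed.

End OddGroup.

(** * Right translations of the Cayley group as permutations of points *)

Theorem theorem10p2 (k : nat) : 3 <= k ->
  ~ is_cayley_graph (@pm_adj (2 * k)).
Proof.
move=> k3 [gT [C [f [[f' fK f'K] _ _ adjE]]]].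
set n := 2 * k in f f' fK f'K adjE *.
have n_even : ~~ odd n by rewrite /n mul2n odd_double.
have n_ge6 : 6 <= n by rewrite /n (leq_mul2l 2 3).
(* Right multiplication leaves [h * g^-1] unchanged, hence preserves adjacency. *)
pose act g (M : pm_vertex n) : pm_vertex n := f' (f M * g)%g.
have actM g h M : act (g * h)%g M = act h (act g M) by rewrite /act f'K mulgA.
have auto g : adj_auto (act g) (act g^-1%g).
  split=> [M|M|M N]; rewrite /act ?f'K ?mulgK ?mulgKV ?fK //.
  by rewrite !adjE !f'K invMg mulgA mulgK.
pose carries g (s : {perm 'I_n}) := [forall M, forall x, mate (act g M) (s x) == s (mate M x)].
have carriesP g (s : {perm 'I_n}) : reflect (forall M x, mate (act g M) (s x) = s (mate M x)) (carries g s).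
  apply: (iffP forallP) => [h M x|h M]; first by have /forallP/(_ x)/eqP := h M.
  by apply/forallP => x; apply/eqP.
pose H := [set s : {perm 'I_n} | [exists g, carries g s]].
have H1 : group_set H.
  apply/group_setP; split=> [|s t].
    rewrite inE; apply/existsP; exists 1%g; apply/carriesP => M x.
    by rewrite !perm1 /act mulg1 fK.
  rewrite !inE => /existsP[g /carriesP gs] /existsP[h /carriesP ht].
  by apply/existsP; exists (g * h)%g; apply/carriesP => M x; rewrite !permM actM ht gs.
apply: (@no_regular_perm_group n (Group H1) n_even n_ge6).
  (* Right translation by this element takes M to N. *)
  move=> M N; have [s hs] := adj_auto_perm n_even n_ge6 (auto ((f M)^-1 * f N)%g).
  exists s; first by rewrite inE; apply/existsP; eexists; apply/carriesP; apply: hs.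
  by move=> x; rewrite -hs /act mulgA mulgV mul1g fK.
move=> M s; rewrite inE => /existsP[g /carriesP gs] sM.
have gM : act g M = M.
  by apply: mate_inj => x; rewrite -[x](permKV s) gs sM.
have g1 : g = 1%g by apply: (mulgI (f M)); rewrite mulg1 -[RHS]f'K -{2}gM /act !f'K.
have sN N x : mate N (s x) = s (mate N x) by rewrite -gs g1 /act mulg1 fK.
apply/permP => x; rewrite perm1; have [//|/eqP sx] := eqVneq (s x) x.
(* Now [s] preserves every matching. If it moved [x], then {x, y} and {s x, s y} would be distinct
   edges, and some matching would contain only the first. *)
have [y] := @fresh_point _ n_ge6 [:: x; s x] isT; rewrite !inE negb_or.
move=> /andP[/eqP /nesym xy /eqP ysx].
have [||N [Nx Nsx]] := @exists_mate_avoiding _ n_even n_ge6 x y (s x) (s y) xy.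
- by case.
- by case=> ? _; congruence.
by case: Nsx; rewrite sN Nx.
Qed.
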